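(* Let $\mathbb{V}_7$ be the exceptional Vidinli algebra with unit $e_1$ and hyperplane $V_0=e_1^\perp$, and let $[a,b]=a\veebar_7 b-b\veebar_7 a$. Then: (i) For $a,b\in V_0$ one has $[a,b]=2\,\omega(a,b)\,e_1$, and $[e_1,a]=0$ for all $a\in\mathbb{V}_7$. (ii) The bracket $[\cdot,\cdot]$ satisfies the Jacobi identity and defines a $2$-step nilpotent Lie algebra structure on $\mathbb{V}_7$ with center $\mathbb{R}e_1$. (iii) The Lie algebra $(\mathbb{V}_7,[\cdot,\cdot])$ is isomorphic to the real Heisenberg Lie algebra $\mathfrak{h}_3$ of dimension $7$, with center $\mathbb{R}e_1$ and the subspace $V_0$ satisfying $[u,v]=2\,\omega(u,v)\,e_1$ for $u,v\in V_0$.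
   Context: Let $\{e_1,\dots,e_7\}$ be the standard orthonormal basis of $\mathbb{R}^7$ with Euclidean inner product $\langle\cdot,\cdot\rangle$, dual basis $\omega^1,\dots,\omega^7$, and $\omega^{ijk}=\omega^i\wedge\omega^j\wedge\omega^k$. Let $$\Phi=\omega^{123}+\omega^{145}+\omega^{167}+\omega^{246}-\omega^{257}-\omega^{347}-\omega^{356},$$ and let $\times$ be the bilinear cross product on $\mathbb{R}^7$ characterized by $\langle u\times v,w\rangle=\Phi(u,v,w)$. The exceptional Vidinli algebra $\mathbb{V}_7=(\mathbb{R}^7,\veebar_7)$ has the bilinear product $$a\veebar_7 b=\langle a,e_1\rangle b+\langle b,e_1\rangle a-\langle a,b\rangle e_1+\langle e_1,a\times b\rangle e_1 .$$ Here $\omega(a,b)=\langle e_1,a\times b\rangle$. The real Heisenberg Lie algebra $\mathfrak{h}_3$ is the $7$-dimensional real Lie algebra with basis $p_1,p_2,p_3,q_1,q_2,q_3,z$ whose brackets are $[p_i,q_j]=\delta_{ij}z$, $[p_i,p_j]=[q_i,q_j]=0$, and $z$ central. *)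

(* Defs.v *)
From mathcomp Require Import all_boot all_order all_algebra.
From mathcomp Require Import reals ring.

Set Implicit Arguments.
Unset Strict Implicit.
Unset Printing Implicit Defensive.

Import Order.TTheory GRing.Theory Num.Theory.
Local Open Scope ring_scope.

Section LieAlgebras.
Variables (K : fieldType).

Section Bracket.
Variables (V : vectType K) (br : V -> V -> V).

Record is_lie_bracket : Prop := IsLieBracket {
  lie_linearl : forall y, linear (br ^~ y);
  lie_linearr : forall x, linear (br x);
  lie_alternating : forall x, br x x = 0;
  lie_jacobi : forall x y z,
    br x (br y z) + br y (br z x) + br z (br x y) = 0 }.

Definition lie_center (x : V) : Prop := forall y, br x y = 0.

(* The term of index [k] is C^k, where C^0 = V and C^(k+1) = [V, C^k] is the
   intersection of all the subspaces that contain the brackets [y, z] for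
   y in V and z in C^k. *)
Fixpoint lower_central (k : nat) : V -> Prop :=
  if k is k'.+1 then
    fun x => forall U : {vspace V},
      (forall y z, lower_central k' z -> br y z \in U) -> x \in U
  else fun=> True.

Definition lower_central_trivial (k : nat) : Prop :=
  forall x, lower_central k x -> x = 0.

(* The nilpotency class is exactly [k], so 2-step nilpotent algebras are not
   abelian. *)
Definition step_nilpotent (k : nat) : Prop :=
  lower_central_trivial k /\
  (forall m, lower_central_trivial m -> (k <= m)%N).

End Bracket.

Definition lie_isomorphic (V W : vectType K)
    (brV : V -> V -> V) (brW : W -> W -> W) : Prop :=
  exists f : {linear V -> W},
    bijective f /\ (forall x y, f (brV x y) = brW (f x) (f y)).

End LieAlgebras.

Section Heisenberg.
Variables (K : fieldType) (n : nat).

(* The coordinates are ordered as p_1, ..., p_n, q_1, ..., q_n, z. *)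
Definition heis_pi (i : 'I_n) : 'I_(n + n + 1) := lshift 1 (lshift n i).
Definition heis_qi (i : 'I_n) : 'I_(n + n + 1) := lshift 1 (rshift n i).
Definition heis_zi : 'I_(n + n + 1) := rshift (n + n) ord0.

Definition heis_p (i : 'I_n) : 'rV[K]_(n + n + 1) := delta_mx 0 (heis_pi i).
Definition heis_q (i : 'I_n) : 'rV[K]_(n + n + 1) := delta_mx 0 (heis_qi i).
Definition heis_z : 'rV[K]_(n + n + 1) := delta_mx 0 heis_zi.

(* The bilinear extension of the brackets of the basis vectors, which are
   recovered in [heis_bracketP] below. *)
Definition heis_bracket (x y : 'rV[K]_(n + n + 1)) : 'rV[K]_(n + n + 1) :=
  (\sum_(i < n) (x 0 (heis_pi i) * y 0 (heis_qi i)
                 - x 0 (heis_qi i) * y 0 (heis_pi i))) *: heis_z.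

Lemma heis_bracket_lie : is_lie_bracket heis_bracket.
Proof.
have z0 i : heis_z 0 (heis_pi i) = 0.
  by rewrite mxE /= /heis_pi /heis_zi eq_lrshift.
have z1 i : heis_z 0 (heis_qi i) = 0.
  by rewrite mxE /= /heis_qi /heis_zi eq_lrshift.
have br0 x y z : heis_bracket x (heis_bracket y z) = 0.
  rewrite {1}/heis_bracket big1 ?scale0r // => i _.
  by rewrite ![heis_bracket _ _ _ _]mxE z0 z1 !mulr0 subrr.
split=> [y a u v|x a u v|x|x y z]; rewrite ?br0 ?addr0 //.
- rewrite /heis_bracket scalerA -scalerDl mulr_sumr -big_split /=.
  congr (_ *: _); apply: eq_bigr => i _; rewrite !mxE.
  by ring.
- rewrite /heis_bracket scalerA -scalerDl mulr_sumr -big_split /=.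
  congr (_ *: _); apply: eq_bigr => i _; rewrite !mxE.
  by ring.
- rewrite /heis_bracket big1 ?scale0r // => i _.
  by rewrite mulrC subrr.
Qed.

Lemma heis_bracketP (i j : 'I_n) :
  [/\ heis_bracket (heis_p i) (heis_q j) = (i == j)%:R *: heis_z,
      heis_bracket (heis_p i) (heis_p j) = 0,
      heis_bracket (heis_q i) (heis_q j) = 0
    & forall x, heis_bracket heis_z x = 0].
Proof.
have E (k l : 'I_n) : [/\ heis_p k 0 (heis_pi l) = (l == k)%:R,
   heis_p k 0 (heis_qi l) = 0, heis_q k 0 (heis_pi l) = 0
   & heis_q k 0 (heis_qi l) = (l == k)%:R].
  by split; rewrite mxE /= /heis_pi /heis_qi eq_lshift ?eq_lshift ?eq_rshift
    ?eq_lrshift ?eq_rlshift.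
split=> [||| x]; rewrite /heis_bracket.
- congr (_ *: _); rewrite (bigD1 i) //= big1 ?addr0 => [|k ki].
    by case: (E i i) (E j i) => -> -> _ _ [_ _ -> ->]; rewrite eqxx mul1r mul0r subr0.
  by case: (E i k) (E j k) => -> -> _ _ [_ _ -> ->]; rewrite (negPf ki) !mul0r subr0.
- rewrite big1 ?scale0r // => k _.
  by case: (E i k) (E j k) => _ -> _ _ [_ -> _ _]; rewrite mul0r mulr0 subr0.
- rewrite big1 ?scale0r // => k _.
  by case: (E i k) (E j k) => _ _ -> _ [_ _ -> _]; rewrite mul0r mulr0 subr0.
- rewrite big1 ?scale0r // => k _.
  by rewrite !mxE /= /heis_pi /heis_qi /heis_zi !eq_lrshift !mul0r subr0.
Qed.

End Heisenberg.

Section Vidinli.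
Variable R : realType.
Implicit Types u v w a b : 'rV[R]_7.

Definition dot u v : R := \sum_i u 0 i * v 0 i.

(* Basis vectors and coordinates are numbered from 1 to 7. *)
Definition idx (k : nat) : 'I_7 := inord k.-1.
Definition e (k : nat) : 'rV[R]_7 := delta_mx 0 (idx k).

(* The 3-form omega^{ijk}, normalized so that its value at (e_i, e_j, e_k)
   is 1. *)
Definition omega3 (i j k : nat) u v w : R :=
  \det (\matrix_(s < 3, t < 3)
          (nth 0 [:: u; v; w] s) 0 (idx (nth 0%N [:: i; j; k] t))).

Definition Phi u v w : R :=
  omega3 1 2 3 u v w + omega3 1 4 5 u v w + omega3 1 6 7 u v w
  + omega3 2 4 6 u v w - omega3 2 5 7 u v w - omega3 3 4 7 u v w
  - omega3 3 5 6 u v w.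

Definition cross u v : 'rV[R]_7 := \row_i Phi u v (delta_mx 0 i).

Lemma dot_delta u i : dot u (delta_mx 0 i) = u 0 i.
Proof.
rewrite /dot (bigD1 i) //= big1 ?addr0 => [|j ji].
  by rewrite mxE !eqxx mulr1.
by rewrite mxE eqxx (negPf ji) mulr0.
Qed.

Let last3 : 'I_3 := lift ord0 (lift ord0 ord0).

Lemma omega3_sumr i j k u v w :
  omega3 i j k u v w = \sum_l omega3 i j k u v (delta_mx 0 l) * w 0 l.
Proof.
pose c t := cofactor (\matrix_(s < 3, t < 3)
  (nth 0 [:: u; v; w] s) 0 (idx (nth 0%N [:: i; j; k] t))) last3 t.
have E x : omega3 i j k u v x
    = \sum_t x 0 (idx (nth 0%N [:: i; j; k] (t : 'I_3))) * c t.
  rewrite /omega3 (expand_det_row _ last3); apply: eq_bigr => t _.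
  rewrite mxE /=; congr (_ * _).
  rewrite /c /cofactor; congr (_ * \det _); apply/matrixP => s r.
  rewrite !mxE; congr (_ _ _); case: s => [] [|[|s]] hs //.
rewrite E; under [RHS]eq_bigr do rewrite E mulr_suml.
rewrite exchange_big; apply: eq_bigr => t _ /=.
set m := idx _; rewrite (bigD1 m) //= big1 ?addr0 => [|l lm].
  by rewrite mxE !eqxx mul1r mulrC.
by rewrite mxE eqxx eq_sym (negPf lm) !mul0r.
Qed.

Lemma crossP u v w : dot (cross u v) w = Phi u v w.
Proof.
rewrite /dot; under eq_bigr do rewrite mxE /Phi !(mulrDl, mulNr).
by rewrite !big_split /= !sumrN -!omega3_sumr.
Qed.

Lemma cross_unique u v x : (forall w, dot x w = Phi u v w) -> x = cross u v.
Proof. by move=> H; apply/rowP => i; rewrite -dot_delta H mxE. Qed.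

Definition omega a b : R := dot (e 1) (cross a b).

(* The product of the algebra V_7, whose unit is [e 1]. *)
Definition vee a b : 'rV[R]_7 :=
  dot a (e 1) *: b + dot b (e 1) *: a - dot a b *: e 1 + omega a b *: e 1.

Lemma dotC u v : dot u v = dot v u.
Proof. by apply: eq_bigr => i _; rewrite mulrC. Qed.

Lemma omega3_alt13 i j k u v : omega3 i j k u v u = 0.
Proof.
by rewrite /omega3 (@determinant_alternate _ _ _ ord0 last3) // => t; rewrite !mxE.
Qed.

Lemma omega3_alt23 i j k u v : omega3 i j k u v v = 0.
Proof.
rewrite /omega3 (@determinant_alternate _ _ _ (lift ord0 ord0) last3) // => t.
by rewrite !mxE.
Qed.

Lemma vee1l a : vee (e 1) a = a.
Proof.
rewrite /vee /omega [dot (e 1) (cross _ _)]dotC crossP /Phi !omega3_alt13.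
by rewrite dot_delta mxE !eqxx scale1r (dotC a) addrK !(addr0, subr0) scale0r addr0.
Qed.

Lemma vee1r a : vee a (e 1) = a.
Proof.
rewrite /vee /omega [dot (e 1) (cross _ _)]dotC crossP /Phi !omega3_alt23.
rewrite dot_delta [dot (e 1) _]dot_delta [e 1 _ _]mxE !eqxx scale1r.
by rewrite [_ *: _ + a]addrC addrK !(addr0, subr0) scale0r addr0.
Qed.

Definition hyperplane a : Prop := dot a (e 1) = 0.

Definition bracket a b : 'rV[R]_7 := vee a b - vee b a.

End Vidinli.

Arguments e {R} k.

(* Main.v *)
Require Import Defs.
From HB Require Import structures.
From mathcomp Require Import all_boot all_order all_algebra.
From mathcomp Require Import reals.
From mathcomp Require Import ring.

Import Order.TTheory GRing.Theory Num.Theory.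
Local Open Scope ring_scope.

(** The product [vee] is symmetric except for its last term, because [dot] is
    symmetric; its antisymmetric part is therefore twice [omega] times the unit
    [e 1], for all arguments and not only on the hyperplane.  Since [omega a b]
    is [Phi a b (e 1)], only the three monomials of [Phi] that contain the
    index 1 contribute, and [omega] is
      [omega^{23} + omega^{45} + omega^{67}],
    the standard symplectic form of the hyperplane orthogonal to [e 1],
    extended by zero along [e 1] ([omegaE]).

    Everything follows from this.  The form is bilinear and alternating and the
    bracket takes its values on the line of [e 1], which is in the radical of
    the form; so all double brackets vanish, which gives the Jacobi identity
    and nilpotency of class at most 2, and the class is exactly 2 because the
    form is not zero.  The center is the radical of the form, which is exactly
    that line because the form is nondegenerate on the hyperplane
    ([bracket_center]).  Finally [e_2, e_4, e_6] and [e_3, e_5, e_7] are dual to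
    each other for [omega], so they give [p_i] and [q_i], up to the factor 2
    that has to be absorbed in one of the two families ([bracket_heisenberg]). *)

(** * The symplectic form *)

Section Omega.
Variable R : realType.
Implicit Types a b u v w x y : 'rV[R]_7.

Lemma omega3E i j k u v w :
  omega3 i j k u v w =
    u 0 (idx i) * (v 0 (idx j) * w 0 (idx k) - v 0 (idx k) * w 0 (idx j))
  - u 0 (idx j) * (v 0 (idx i) * w 0 (idx k) - v 0 (idx k) * w 0 (idx i))
  + u 0 (idx k) * (v 0 (idx i) * w 0 (idx j) - v 0 (idx j) * w 0 (idx i)).
Proof.
rewrite /omega3 (expand_det_row _ ord0) !big_ord_recl big_ord0 /cofactor.
rewrite !(expand_det_row _ ord0) !big_ord_recl !big_ord0 /cofactor !det_mx11.
by rewrite !mxE /= /bump /=; ring.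
Qed.

Lemma idx_eq k l : (k.-1 < 7)%N -> (l.-1 < 7)%N ->
  (idx k == idx l) = (k.-1 == l.-1).
Proof. by move=> hk hl; rewrite -val_eqE /= !inordK. Qed.

Lemma e_coord k l : (k.-1 < 7)%N -> (l.-1 < 7)%N ->
  (e k : 'rV[R]_7) 0 (idx l) = (l.-1 == k.-1)%:R.
Proof. by move=> hk hl; rewrite mxE eqxx /= idx_eq. Qed.

(** Unlike [mxE], these rules leave the coordinates of [e k] folded, so that
    [e_coord] can compute them. *)
Lemma row_linE n i :
  ((forall u v : 'rV[R]_n, (u + v)%R 0 i = (u 0 i + v 0 i)%R)
   * (forall c (u : 'rV[R]_n), (c *: u)%R 0 i = (c * u 0 i)%R)
   * ((0 : 'rV[R]_n) 0 i = 0))%type.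
Proof. by split=> [|]; first split=> *; rewrite mxE. Qed.

Lemma omegaE a b :
  omega a b = a 0 (idx 2) * b 0 (idx 3) - a 0 (idx 3) * b 0 (idx 2)
            + (a 0 (idx 4) * b 0 (idx 5) - a 0 (idx 5) * b 0 (idx 4))
            + (a 0 (idx 6) * b 0 (idx 7) - a 0 (idx 7) * b 0 (idx 6)).
Proof.
rewrite /omega dotC crossP /Phi !omega3E !e_coord //=.
by ring.
Qed.

Lemma omega_alternating a : omega a a = 0.
Proof. by rewrite omegaE; ring. Qed.

Lemma omega_antisym a b : omega b a = - omega a b.
Proof. by rewrite !omegaE; ring. Qed.

Lemma omega_linearl b c u v : omega (c *: u + v) b = c * omega u b + omega v b.
Proof. by rewrite !omegaE !mxE; ring. Qed.

Lemma omega_linearr a c u v : omega a (c *: u + v) = c * omega a u + omega a v.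
Proof. by rewrite !omegaE !mxE; ring. Qed.

Lemma omega_e1r a c : omega a (c *: e 1) = 0.
Proof. by rewrite omegaE !row_linE !e_coord //=; ring. Qed.

Lemma row7P x y :
  (forall k, (0 < k <= 7)%N -> x 0 (idx k) = y 0 (idx k)) -> x = y.
Proof.
move=> xy; apply/rowP => i; have := xy i.+1.
by rewrite /idx /= inord_val; apply; exact: ltn_ord.
Qed.

(** Pairing [x] with the dual basis vector of [e k] recovers, up to sign, the
    [k]-th coordinate for every [k > 1]; so only the first one is left free. *)
Lemma omega_radical x :
  (forall y, omega x y = 0) -> x = x 0 (idx 1) *: e 1.
Proof.
move=> x0; apply: row7P => k.
have := (x0 (e 3), x0 (e 2), x0 (e 5), x0 (e 4), x0 (e 7), x0 (e 6)).
rewrite !omegaE !e_coord //= !(mulr0, mulr1, subr0, sub0r, addr0, add0r, oppr0).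
have oppr0_eq (t : R) : - t = 0 -> t = 0 by move/eqP; rewrite oppr_eq0 => /eqP.
case=> [[[[[x2 /oppr0_eq x3] x4] /oppr0_eq x5] x6] /oppr0_eq x7].
rewrite mxE; case: k => [//|[|[|[|[|[|[|[|//]]]]]]]] _;
  by rewrite e_coord //= ?mulr1 ?mulr0.
Qed.

(** * The bracket *)

Lemma bracketE a b : bracket a b = (2 * omega a b) *: e 1.
Proof.
rewrite /bracket /vee (omega_antisym a b) (dotC b a).
by apply/rowP => i; rewrite !mxE; ring.
Qed.

Lemma bracket_bracket a b c : bracket a (bracket b c) = 0.
Proof. by rewrite (bracketE b) bracketE omega_e1r mulr0 scale0r. Qed.

Lemma bracket_e1l a c : bracket (c *: e 1) a = 0.
Proof.
by rewrite bracketE omega_antisym omega_e1r oppr0 mulr0 scale0r.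
Qed.

Lemma bracket_lie : is_lie_bracket (@bracket R).
Proof.
split=> [y c u v|x c u v|x|x y z].
- by rewrite !bracketE omega_linearl scalerA -scalerDl; congr (_ *: _); ring.
- by rewrite !bracketE omega_linearr scalerA -scalerDl; congr (_ *: _); ring.
- by rewrite bracketE omega_alternating mulr0 scale0r.
- by rewrite !bracket_bracket !addr0.
Qed.

Lemma e1_neq0 : (e 1 : 'rV[R]_7) != 0.
Proof.
by apply/eqP => /rowP/(_ (idx 1))/eqP; rewrite e_coord // mxE oner_eq0.
Qed.

Lemma bracket_e2e3 : bracket (e 2) (e 3) = 2 *: e 1 :> 'rV[R]_7.
Proof. by rewrite bracketE omegaE !e_coord //=; congr (_ *: _); ring. Qed.

Lemma bracket_step2 : step_nilpotent (@bracket R) 2.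
Proof.
split=> [x /(_ 0%VS) x0|m triv].
  (* C^1 lies in the line of e_1, so C^2 lies in the zero subspace. *)
  apply/eqP; rewrite -memv0; apply: x0 => y z /(_ <[e 1]>%VS) z1.
  have /vlineP[c ->]: z \in <[e 1]>%VS.
    by apply: z1 => u v _; rewrite bracketE memvZ // memv_line.
  by rewrite bracketE omega_e1r mulr0 scale0r mem0v.
(* C^0 contains e_1, and so does C^1 because [e_2, e_3] = 2 e_1. *)
case: m triv => [|[|//]] triv; case/eqP: e1_neq0; first exact: triv.
apply: triv => U brU; have := brU (e 2) (e 3) I.
by rewrite bracket_e2e3 rpredZeq pnatr_eq0.
Qed.

Lemma bracket_center x :
  lie_center (@bracket R) x <-> x \in <[e 1 : 'rV[R]_7]>%VS.
Proof.
split=> [cx|/vlineP[c ->] y]; last exact: bracket_e1l.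
rewrite (@omega_radical x) ?memvZ ?memv_line // => y.
move/eqP: (cx y); rewrite bracketE scaler_eq0 (negPf e1_neq0) orbF.
by rewrite mulf_eq0 pnatr_eq0 => /eqP.
Qed.

(** * The isomorphism with the Heisenberg algebra *)

(** The basis vectors [e_2, e_4, e_6] go to the [p_i], [e_3, e_5, e_7] to the
    [2 q_i] and [e_1] to [z]: the bracket of [e_2] and [e_3] is [2 e_1], and
    that of [p_1] and [2 q_1] is [2 z]. *)
Definition to_heis x : 'rV[R]_(3 + 3 + 1) :=
  row_mx (row_mx (\row_i x 0 (idx (2 * i + 2)))
                 (\row_i (2 * x 0 (idx (2 * i + 3)))))
         (\row__ x 0 (idx 1)).

Lemma to_heis_p x i : to_heis x 0 (heis_pi i) = x 0 (idx (2 * i + 2)).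
Proof. by rewrite !row_mxEl mxE. Qed.

Lemma to_heis_q x i : to_heis x 0 (heis_qi i) = 2 * x 0 (idx (2 * i + 3)).
Proof. by rewrite row_mxEl row_mxEr mxE. Qed.

Lemma to_heis_z x : to_heis x 0 (heis_zi 3) = x 0 (idx 1).
Proof. by rewrite row_mxEr mxE. Qed.

Lemma heis_rowP (x y : 'rV[R]_(3 + 3 + 1)) :
  (forall i, x 0 (heis_pi i) = y 0 (heis_pi i)) ->
  (forall i, x 0 (heis_qi i) = y 0 (heis_qi i)) ->
  x 0 (heis_zi 3) = y 0 (heis_zi 3) -> x = y.
Proof.
move=> xy_p xy_q xy_z; apply/rowP => i; case: (split_ordP i) => j ->.
  by case: (split_ordP j) => k ->; [exact: xy_p|exact: xy_q].
by rewrite (ord1 j).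
Qed.

Lemma to_heis_linear : linear to_heis.
Proof.
by move=> c u v; apply: heis_rowP => [i|i|];
  rewrite row_linE row_linE ?to_heis_p ?to_heis_q ?to_heis_z !row_linE; ring.
Qed.

HB.instance Definition _ := GRing.isLinear.Build R 'rV[R]_7
  'rV[R]_(3 + 3 + 1) *:%R to_heis to_heis_linear.

Definition of_heis (y : 'rV[R]_(3 + 3 + 1)) : 'rV[R]_7 :=
  \sum_(i < 3) (y 0 (heis_pi i) *: e (2 * i + 2)
                + (y 0 (heis_qi i) / 2) *: e (2 * i + 3))
  + y 0 (heis_zi 3) *: e 1.

Lemma to_heisK : cancel to_heis of_heis.
Proof.
move=> x; apply: row7P => k; rewrite /of_heis.
rewrite !big_ord_recl big_ord0 !to_heis_p !to_heis_q to_heis_z /=.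
rewrite /bump /= ?muln0 ?add0n.
case: k => [//|[|[|[|[|[|[|[|//]]]]]]]] _;
  rewrite !row_linE !e_coord //=;
  by field.
Qed.

Lemma ord3P (i : 'I_3) :
  [\/ i = ord0, i = lift ord0 ord0 | i = lift ord0 (lift ord0 ord0)].
Proof.
by case: i => [[|[|[|//]]] li]; [constructor 1|constructor 2|constructor 3];
  apply: val_inj.
Qed.

Lemma of_heisK : cancel of_heis to_heis.
Proof.
move=> y; apply: heis_rowP => [i|i|];
  rewrite ?to_heis_p ?to_heis_q ?to_heis_z /of_heis !big_ord_recl big_ord0 /=;
  rewrite /bump /= ?muln0 ?add0n; last by rewrite !row_linE !e_coord //=; ring.
- by case: (ord3P i) => ->; rewrite !row_linE !e_coord //=; ring.
- by case: (ord3P i) => ->; rewrite !row_linE !e_coord //=; field.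
Qed.

Lemma bracket_heisenberg : lie_isomorphic (@bracket R) (@heis_bracket R 3).
Proof.
exists to_heis; split=> [|x y].
  by exists of_heis; [exact: to_heisK|exact: of_heisK].
have to_heis_e1 : to_heis (e 1) = heis_z R 3.
  apply: heis_rowP => [i|i|]; rewrite ?to_heis_p ?to_heis_q ?to_heis_z /heis_z.
  - by rewrite [RHS]mxE eq_lrshift; case: (ord3P i) => ->; rewrite e_coord.
  - by rewrite [RHS]mxE eq_lrshift; case: (ord3P i) => ->; rewrite e_coord ?mulr0.
  - by rewrite e_coord // mxE !eqxx.
rewrite bracketE linearZ /= to_heis_e1 /heis_bracket; congr (_ *: _).
rewrite !big_ord_recl big_ord0 !to_heis_p !to_heis_q omegaE /= /bump /=.
by ring.
Qed.

End Omega.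

Theorem theorem3p12 (R : realType) :
  [/\
    (* (i) *)
    (forall a b : 'rV[R]_7, hyperplane a -> hyperplane b ->
       bracket a b = (2 * omega a b) *: e 1)
    /\ (forall a : 'rV[R]_7, bracket (e 1) a = 0),

    (* (ii) *)
    [/\ is_lie_bracket (@bracket R),
        step_nilpotent (@bracket R) 2
      & forall x : 'rV[R]_7,
          lie_center (@bracket R) x <-> x \in <[e 1 : 'rV[R]_7]>%VS]

    (* (iii) *)
  & [/\ lie_isomorphic (@bracket R) (@heis_bracket R 3),
        forall x : 'rV[R]_7,
          lie_center (@bracket R) x <-> x \in <[e 1 : 'rV[R]_7]>%VS
      & forall u v : 'rV[R]_7, hyperplane u -> hyperplane v ->
          bracket u v = (2 * omega u v) *: e 1]].
Proof.
have br0 (a b : 'rV[R]_7) (_ : hyperplane a) (_ : hyperplane b) :=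
  bracketE R a b.
split; first split=> // a.
- by rewrite -[e 1]scale1r bracket_e1l.
- by split; [exact: bracket_lie|exact: bracket_step2|exact: bracket_center].
- by split; [exact: bracket_heisenberg|exact: bracket_center|].
Qed.
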